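(* Let $G_2$ be a finite nilpotent group which acts trivially on an abelian torsion group $G_1$, and let $\varepsilon_1,\varepsilon_2\in Z^2(G_2,G_1)$. Let $\pi(G_2)=\{p_1,\dots,p_k\}$ be the set of prime divisors of $|G_2|$ and, for each $1\le i\le k$, let $G_{2i}$ be the Sylow $p_i$-subgroup of $G_2$, let $G_{1p_i}$ be the $p_i$-component of $G_1$, and let $\varepsilon_{1i},\varepsilon_{2i}\in Z^2(G_{2i},G_{1p_i})$ be the cocycles induced by $\varepsilon_1,\varepsilon_2$ respectively. If all the Sylow subgroups of $G_2$ are of coclass at most two, then $G_1\underset{\varepsilon_1}{\times}G_2$ and $G_1\underset{\varepsilon_2}{\times}G_2$ are upper $\mathcal{A}$-isomorphic if and only if $G_{1p_i}\underset{\varepsilon_{1i}}{\times}G_{2i}$ and $G_{1p_i}\underset{\varepsilon_{2i}}{\times}G_{2i}$ are upper $\mathcal{A}$-isomorphic for all $1\le i\le k$.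
   Context: Groups are written multiplicatively. For a group $Q$ acting trivially on an abelian group $A$, $Z^2(Q,A)$ is the group of normalized 2-cocycles, i.e. maps $\varepsilon:Q\times Q\to A$ with $\varepsilon(g,1)=\varepsilon(1,g)=1$ and $\varepsilon(h,g)\varepsilon(hg,k)=\varepsilon(g,k)\varepsilon(h,gk)$ for all $g,h,k\in Q$. The perturbed direct product $A\underset{\varepsilon}{\times}Q$ is the group with underlying set $A\times Q$ and operation $(x,y)(x',y')=(xx'\varepsilon(y,y'),yy')$. For a homomorphism $\varphi:A\underset{\varepsilon}{\times}Q\to A\underset{\varepsilon'}{\times}Q$, write $\varphi_{22}(y)$ for the $Q$-coordinate of $\varphi(1,y)$ ($y\in Q$). A commuting automorphism of a group $Q$ is an automorphism $\rho$ such that $\rho(x)$ commutes with $x$ for every $x\in Q$; $\mathcal{A}(Q)$ is the set of commuting automorphisms of $Q$. The groups $A\underset{\varepsilon}{\times}Q$ and $A\underset{\varepsilon'}{\times}Q$ are called upper $\mathcal{A}$-isomorphic if there is a group isomorphism $\varphi$ from the first to the second which leaves $A$ invariant, i.e. $\varphi(A\times\{1\})=A\times\{1\}$, and satisfies $\varphi_{22}\in\mathcal{A}(Q)$. A finite $p$-group of order $p^n$ and nilpotency class $c$ has coclass $n-c$. An abelian torsion group $G_1$ is the restricted direct product of its $p$-components $G_{1p}$ (the subgroup of elements of $p$-power order). For $j\in\{1,2\}$, $\varepsilon_{ji}$ denotes the restriction of $\varepsilon_j$ to $G_{2i}\times G_{2i}$ followed by the projection $G_1\to G_{1p_i}$.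 *)

(* Defs.v *)
From HB Require Import structures.
From mathcomp Require Import all_boot all_fingroup all_solvable.

Set Implicit Arguments.
Unset Strict Implicit.
Unset Printing Implicit Defensive.

Local Open Scope group_scope.

(* Possibly infinite abelian groups, written multiplicatively. *)
HB.mixin Record isAbelianGroup G of monoid.Group G := {
  mulg_comm : commutative (@mul G)
}.

#[short(type="abGroupType")]
HB.structure Definition AbGroup := {G of monoid.Group G & isAbelianGroup G}.

HB.mixin Record isTorsionGroup G of monoid.Group G := {
  torsion_subproof : forall x : G, exists n, (0 < n)%N && (x ^+ n == 1)
}.

#[short(type="torsionAbGroupType")]
HB.structure Definition TorsionAbGroup :=
  {G of AbGroup G & isTorsionGroup G}.

Section AbTheory.
Variable A : abGroupType.
Implicit Types x y z : A.

Lemma mulg_AC x y z : x * y * z = x * z * y.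
Proof. by rewrite -!mulgA (mulg_comm y). Qed.

Lemma mulg_ACA x y z t : x * y * (z * t) = x * z * (y * t).
Proof. by rewrite !mulgA (mulg_AC x y). Qed.

End AbTheory.

(* Normalized 2-cocycles for the trivial action of Q on A. *)
Definition normalized_cocycle (Q : groupType) (A : abGroupType)
    (e : Q -> Q -> A) : Prop :=
  [/\ forall g, e g 1 = 1,
      forall g, e 1 g = 1
    & forall g h k, e h g * e (h * g) k = e g k * e h (g * k)].

Record cocycle (Q : groupType) (A : abGroupType) := Cocycle {
  cocycle_fun :> Q -> Q -> A;
  cocycleP : normalized_cocycle cocycle_fun
}.

(* The alias carries its own group structure, in place of the componentwise
   one on A * Q. *)
Definition perturbed_prod (Q : groupType) (A : abGroupType)
    (e : cocycle Q A) : Type := (A * Q)%type.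

Section PerturbedProduct.
Variables (Q : groupType) (A : abGroupType) (e : cocycle Q A).

HB.instance Definition _ := Choice.copy (perturbed_prod e) (A * Q)%type.

Definition perturbed_one : perturbed_prod e := (1, 1).
Definition perturbed_mul (u v : perturbed_prod e) : perturbed_prod e :=
  (u.1 * v.1 * e u.2 v.2, u.2 * v.2).
Definition perturbed_inv (u : perturbed_prod e) : perturbed_prod e :=
  (u.1^-1 * (e u.2^-1 u.2)^-1, u.2^-1).

Lemma cocycleg1 g : e g 1 = 1. Proof. by case: (cocycleP e). Qed.
Lemma cocycle1g g : e 1 g = 1. Proof. by case: (cocycleP e). Qed.
Lemma cocycleE g h k : e h g * e (h * g) k = e g k * e h (g * k).
Proof. by case: (cocycleP e). Qed.

Lemma cocycle_invC g : e g^-1 g = e g g^-1.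
Proof.
by have := cocycleE g^-1 g g; rewrite mulgV mulVg cocycle1g cocycleg1 !mulg1.
Qed.

Lemma perturbed_mulA : associative perturbed_mul.
Proof.
move=> u v w; rewrite /perturbed_mul /=; congr (_, _); last by rewrite mulgA.
rewrite (mulg_AC (u.1 * v.1) (e u.2 v.2) w.1) !mulgA.
by rewrite -(mulgA _ (e v.2 w.2)) -cocycleE !mulgA.
Qed.

Lemma perturbed_mul1g : left_id perturbed_one perturbed_mul.
Proof. by case=> x y; rewrite /perturbed_mul /= cocycle1g !mul1g mulg1. Qed.

Lemma perturbed_mulg1 : right_id perturbed_one perturbed_mul.
Proof. by case=> x y; rewrite /perturbed_mul /= cocycleg1 !mulg1. Qed.

Lemma perturbed_mulVg : left_inverse perturbed_one perturbed_inv perturbed_mul.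
Proof.
case=> x y; rewrite /perturbed_mul /= mulVg; congr (_, _).
by rewrite mulg_AC mulgVK mulVg.
Qed.

Lemma perturbed_mulgV : right_inverse perturbed_one perturbed_inv perturbed_mul.
Proof.
case=> x y; rewrite /perturbed_mul /= mulgV; congr (_, _).
by rewrite mulgA mulgV mul1g cocycle_invC mulVg.
Qed.

HB.instance Definition _ := isGroup.Build (perturbed_prod e)
  perturbed_mulA perturbed_mul1g perturbed_mulg1 perturbed_mulVg perturbed_mulgV.

Lemma perturbed_mulE (u v : perturbed_prod e) :
  u * v = (u.1 * v.1 * e u.2 v.2, u.2 * v.2).
Proof. by []. Qed.

End PerturbedProduct.

Definition commuting_automorphism (Q : groupType) (rho : Q -> Q) : Prop :=
  [/\ {morph rho : x y / x * y}, bijective rho & forall x, commute (rho x) x].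

Section UpperIsomorphism.
Variables (Q : groupType) (A : abGroupType) (e e' : cocycle Q A).

Definition comp22 (phi : perturbed_prod e -> perturbed_prod e') (y : Q) : Q :=
  (phi (1, y)).2.

(* phi (A x 1) = A x 1 *)
Definition leaves_invariant (phi : perturbed_prod e -> perturbed_prod e') : Prop :=
  forall v : perturbed_prod e',
    (exists2 u : perturbed_prod e, u.2 = 1 & phi u = v) <-> v.2 = 1.

Definition upper_A_isomorphic : Prop :=
  exists phi : {multiplicative perturbed_prod e -> perturbed_prod e'},
    [/\ bijective phi, leaves_invariant phi
      & commuting_automorphism (comp22 phi)].

End UpperIsomorphism.

Section Torsion.
Variable A : torsionAbGroupType.
Implicit Types (x y : A) (n : nat).

Definition torsion_order x : nat := ex_minn (torsion_subproof x).

Lemma torsion_order_gt0 x : (0 < torsion_order x)%N.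
Proof. by rewrite /torsion_order; case: ex_minnP => n /andP[]. Qed.

Lemma expg_torsion_order x : x ^+ torsion_order x = 1.
Proof. by rewrite /torsion_order; case: ex_minnP => n /andP[_ /eqP]. Qed.

Lemma torsion_order_dvdn x n : (torsion_order x %| n)%N = (x ^+ n == 1).
Proof.
have xm k m : x ^+ (m * torsion_order x + k) = x ^+ k.
  by rewrite expgnDr mulnC expgnA expg_torsion_order expg1n mul1g.
rewrite {2}(divn_eq n (torsion_order x)) xm /dvdn.
apply/eqP/eqP=> [-> // | xr1].
have := ltn_pmod n (torsion_order_gt0 x); move: xr1.
case: (posnP (n %% torsion_order x)) => // r0 xr1.
rewrite {2}/torsion_order; case: ex_minnP => m _ min_m /=.
by rewrite ltnNge min_m // r0 xr1 eqxx.
Qed.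

Lemma expg_eq_mod x m n : m = n %[mod torsion_order x] -> x ^+ m = x ^+ n.
Proof.
move=> emn; rewrite (divn_eq m (torsion_order x)).
rewrite [in RHS](divn_eq n (torsion_order x)) emn !expgnDr; congr (_ * _).
by rewrite ![(_ * torsion_order x)%N]mulnC !expgnA expg_torsion_order !expg1n.
Qed.

Lemma torsion_orderM x y :
  (torsion_order (x * y)%g %| torsion_order x * torsion_order y)%N.
Proof.
rewrite torsion_order_dvdn expgMn; last exact: mulg_comm.
rewrite expgnA expg_torsion_order expg1n mul1g mulnC expgnA.
by rewrite expg_torsion_order expg1n.
Qed.

Lemma torsion_orderV x : torsion_order x^-1 = torsion_order x.
Proof.
apply/eqP; rewrite eqn_dvd !torsion_order_dvdn expVgn expg_torsion_order invg1.
by rewrite eqxx /= -invg_eq1 -expVgn expg_torsion_order eqxx.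
Qed.

Lemma torsion_order1 : torsion_order (1 : A) = 1%N.
Proof. by apply/eqP; rewrite -dvdn1 torsion_order_dvdn expg1. Qed.

Definition in_pcomponent (p : nat) : pred A := fun x => p.-nat (torsion_order x).

Record pcomponent (p : nat) := PComponent {
  pcomponent_val : A;
  _ : in_pcomponent p pcomponent_val
}.

(* The exponent is 1 modulo the p-part of the order of x and 0 modulo its
   p'-part. *)
Definition pproj_val (p : nat) x : A :=
  let n := torsion_order x in x ^+ chinese n`_p n`_p^' 1 0.

Section PComponent.
Variable p : nat.

HB.instance Definition _ := [isSub for @pcomponent_val p].
HB.instance Definition _ := [Choice of pcomponent p by <:].

Lemma in_pcomponent_closed : group_closed (in_pcomponent p).
Proof.
split=> [|x y px py]; rewrite /in_mem /= /in_pcomponent.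
  by rewrite torsion_order1.
apply: pnat_dvd (torsion_orderM _ _) _.
by rewrite pnatM torsion_orderV; apply/andP.
Qed.

HB.instance Definition _ :=
  SubChoice_isSubGroup.Build A (in_pcomponent p) (pcomponent p)
    in_pcomponent_closed.

Lemma pcomponent_mulC : commutative (@mul (pcomponent p)).
Proof. by move=> x y; apply: val_inj; rewrite !valM mulg_comm. Qed.

HB.instance Definition _ := isAbelianGroup.Build (pcomponent p) pcomponent_mulC.

Lemma pproj_valE x n : (0 < n)%N -> (torsion_order x %| n)%N ->
  pproj_val p x = x ^+ chinese n`_p n`_p^' 1 0.
Proof.
rewrite /pproj_val => n_gt0; set m := torsion_order x => dv_n.
apply: expg_eq_mod; rewrite -/m.
have m_gt0 : (0 < m)%N := torsion_order_gt0 x.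
have crt (k l : nat) : k = l %[mod m`_p] -> k = l %[mod m`_p^'] -> k = l %[mod m].
  move=> /eqP kl /eqP kl'; apply/eqP.
  by rewrite -(partnC p m_gt0) chinese_remainder ?coprime_partC // kl.
apply: crt.
- rewrite chinese_modl ?coprime_partC //; apply/esym.
  rewrite -(modn_dvdm _ (partn_dvd p n_gt0 dv_n)) chinese_modl ?coprime_partC //.
  by rewrite modn_dvdm // partn_dvd.
- rewrite chinese_modr ?coprime_partC //; apply/esym.
  rewrite -(modn_dvdm _ (partn_dvd p^' n_gt0 dv_n)).
  by rewrite chinese_modr ?coprime_partC // modn_dvdm // partn_dvd.
Qed.

Lemma pproj_subproof x : in_pcomponent p (pproj_val p x).
Proof.
rewrite /in_pcomponent; set n := torsion_order x.
apply: (@pnat_dvd _ n`_p); last exact: part_pnat.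
rewrite torsion_order_dvdn /pproj_val -/n -expgnA -torsion_order_dvdn -/n.
have n_gt0 : (0 < n)%N := torsion_order_gt0 x.
rewrite -{1}(partnC p n_gt0) mulnC dvdn_mul //.
by rewrite /dvdn chinese_modr ?coprime_partC // mod0n.
Qed.

(* The projection of the torsion group A onto its p-component. *)
Definition pproj x : pcomponent p := PComponent (pproj_subproof x).

Lemma pprojM : {morph pproj : x y / x * y}.
Proof.
move=> x y; apply: val_inj; rewrite valM /=.
set n := (torsion_order x * torsion_order y)%N.
have n_gt0 : (0 < n)%N by rewrite muln_gt0 !torsion_order_gt0.
have dx : (torsion_order x %| n)%N by exact: dvdn_mulr.
have dy : (torsion_order y %| n)%N by exact: dvdn_mull.
rewrite !(@pproj_valE _ n) ?torsion_orderM //.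
by apply: expgMn; apply: mulg_comm.
Qed.

Lemma pproj1 : pproj 1 = 1.
Proof. by apply: (mulgI (pproj 1)); rewrite -pprojM !mulg1. Qed.

(* Together with pprojM, the next two facts determine pproj. *)
Lemma pprojK (x : pcomponent p) : pproj (val x) = x.
Proof.
apply: val_inj; rewrite /= /pproj_val -[RHS]expg1; apply: expg_eq_mod.
set n := torsion_order _; have /part_pnat_id pn : p.-nat n := valP x.
have := chinese_modl (coprime_partC p n n) 1 0.
by set c := chinese _ _ _ _; rewrite pn.
Qed.

Lemma pproj_p'elt x : p^'.-nat (torsion_order x) -> pproj x = 1.
Proof.
move=> p'x; apply: val_inj; rewrite val1 /= /pproj_val; apply: (@expg_eq_mod x _ 0).
have := chinese_modr (coprime_partC p (torsion_order x) (torsion_order x)) 1 0.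
by set c := chinese _ _ _ _; rewrite (part_pnat_id p'x).
Qed.

End PComponent.
End Torsion.

Section InducedCocycle.
Variables (Q : finGroupType) (A : torsionAbGroupType).
Variables (p : nat) (P : {group Q}) (e : cocycle Q A).

Definition induced_fun (g h : [subg P]) : pcomponent A p :=
  pproj p (e (sgval g) (sgval h)).

Lemma induced_subproof : normalized_cocycle induced_fun.
Proof.
split=> [g|g|g h k]; rewrite /induced_fun.
- by rewrite cocycleg1 pproj1.
- by rewrite cocycle1g pproj1.
- by rewrite -!pprojM cocycleE.
Qed.

(* Restriction to P followed by the projection onto the p-component. *)
Definition induced_cocycle : cocycle (subg_of P) (pcomponent A p) :=
  Cocycle induced_subproof.

End InducedCocycle.

(* For a p-group P; the truncated subtraction is exact, as the class of P is
   at most the exponent of p in its order. *)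
Definition coclass (gT : finGroupType) (p : nat) (P : {group gT}) : nat :=
  (logn p #|P| - nil_class P)%N.

(* Main.v *)
Require Import Defs.
From HB Require Import structures.
From mathcomp Require Import all_boot all_fingroup all_solvable.

(** An isomorphism from the extension of Q by A with cocycle e to the one with
    cocycle e' that preserves A is the same thing as a triple (a, r, t), where
    a is an automorphism of A, r one of Q, and t : Q -> A a cochain such that
    a \o e and the pull-back of e' by r differ by the coboundary of t; the
    isomorphism is (x, y) |-> (a x * t y, r y), and its Q-component is r.  The
    theorem is about the existence of such triples with r commuting.

    A triple for (G2, G1) restricts to each pair (G_2p, G_1p): homomorphisms
    preserve the elements of p-power order (restrict_upper_data).

    Conversely, let (a_p, r_p, t_p) be given for every p.  Both G1 and the
    nilpotent group G2 are products of their primary components, so the a_p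
    and the r_p glue to automorphisms a and r (pr_glue), and r is
    commuting because this can be checked on components.  The t_p do not glue
    directly, since the values of a cocycle on pairs with coordinates in
    different Sylow subgroups are not determined by its restrictions.  The
    existence of t comes from cohomology instead: the cocycle
    f = (a \o e1) / r^* e2 is a coboundary because, for every prime p, the
    p-part of f is a coboundary on a Sylow p-subgroup (coboundary_of_Sylow).

    That criterion rests on the transfer: if f is a coboundary on P then
    f ^ |Q : P| is a coboundary on Q (coboundary_expg_index).  If p
    divides the order of some value of f, then the p-part of f is a power f ^ c
    with p not dividing c, so a power of f with exponent prime to p is a
    coboundary.  As Q is finite and A is torsion, some positive
    power of f is trivial, and a Bezout argument on exponents shows that f is a
    coboundary. *)

Set Implicit Arguments.
Unset Strict Implicit.
Unset Printing Implicit Defensive.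
Local Open Scope group_scope.

(** * Coboundaries and the transfer *)

(** Makes reindexing and regrouping of products available in A. *)
HB.instance Definition _ (A : abGroupType) :=
  SemiGroup.isCommutativeLaw.Build A mul (@mulg_comm A).

Lemma eq_divg (A : abGroupType) (a b c d : A) : a * d = c * b -> a * b^-1 = c * d^-1.
Proof.
move=> eq_ad_cb; apply: (mulIg d); rewrite mulgVK (ACl (1*3*2)) /= eq_ad_cb.
exact: mulgK.
Qed.

Section Coboundary.
Variables (Q : groupType) (A : abGroupType).
Implicit Type f : Q -> Q -> A.

Definition coboundary f : Prop :=
  exists t : Q -> A, forall x y, f x y * t (x * y) = t x * t y.

Lemma coboundaryM f g :
  coboundary f -> coboundary g -> coboundary (fun x y => f x y * g x y).
Proof.
case=> t ft [s gs]; exists (fun x => t x * s x) => x y.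
by rewrite mulg_ACA ft gs mulg_ACA.
Qed.

Lemma coboundaryV f : coboundary f -> coboundary (fun x y => (f x y)^-1).
Proof.
case=> t ft; exists (fun x => (t x)^-1) => x y.
by rewrite -!invgM (mulg_comm (t (x * y))) ft mulg_comm.
Qed.

Lemma coboundaryX f n : coboundary f -> coboundary (fun x y => f x y ^+ n).
Proof.
case=> t ft; exists (fun x => t x ^+ n) => x y.
by rewrite -!expgMn ?ft //; apply: mulg_comm.
Qed.

Lemma eq_coboundary f g : f =2 g -> coboundary f -> coboundary g.
Proof. by move=> fg [t ft]; exists t => x y; rewrite -fg. Qed.

End Coboundary.

Section Transfer.
Variables (Q : finGroupType) (A : abGroupType) (P : {group Q}).
Implicit Types (f : Q -> Q -> A) (t : Q -> A).

(** When f does not change if its first argument is multiplied by P on the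
    left, f C y makes sense for a coset C of P; multiplying the cocycle identity
    over all cosets C as first argument shows that the product of the f C y is
    a cochain with coboundary f ^ |Q : P|, since x permutes the cosets. *)
Lemma transfer_left_invariant f :
    (forall g h k, f h g * f (h * g) k = f g k * f h (g * k)) ->
    {in P, forall p x y, f (p * x) y = f x y} ->
  coboundary (fun x y => f x y ^+ #|[set: Q] : P|).
Proof.
move=> fE fP; pose s k := \prod_(C in rcosets P [set: Q]) f (repr C) k.
exists s => x y.
have f_repr g k : f (repr (P :* g)) k = f g k.
  by case: repr_rcosetP => p Pp; apply: fP.
have ->: s y = \prod_(C in rcosets P [set: Q]) f (repr C * x) y.
  rewrite /s (reindex_inj (can_inj (rcosetK x))) /=.
  apply: eq_big => [C|C /rcosetsP[g _ defC]].
    apply/rcosetsP/rcosetsP=> -[g _ defC]; last first.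
      by exists (g * x); rewrite ?inE // defC rcosetM.
    by exists (g * x^-1); rewrite ?inE // rcosetM -defC rcosetK.
  rewrite defC f_repr -(rcosetK x C) defC -rcosetM.
  by case: repr_rcosetP => p Pp; rewrite -mulgA fP // mulgVK.
rewrite -prodgM_commute; last by move=> *; apply: mulg_comm.
under eq_bigr => C _ do rewrite fE.
rewrite prodgM_commute; last by move=> *; apply: mulg_comm.
by rewrite prodg_const.
Qed.

(** A cochain t on P that trivializes f on P x P extends to a cochain T on Q
    that trivializes f on P x Q: with a representative r of each coset P r,
    set T (p r) = t p / f p r.  The cocycle identity for (p, p', r) is exactly
    what makes this work for all of P r. *)
Lemma trivialize_left f t : normalized_cocycle f ->
    {in P &, forall x y, f x y * t (x * y) = t x * t y} ->
  exists T : Q -> A, {in P, forall p x, f p x * T (p * x) = T p * T x}.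
Proof.
case=> f1 _ fE ft; pose r (x : Q) := repr (P :* x); pose u (x : Q) : Q := x * (r x)^-1.
have uP x : u x \in P.
  by rewrite /u /r; case: repr_rcosetP => p Pp; rewrite invMg mulKVg groupV.
have rE p x : p \in P -> r (p * x) = r x.
  by move=> Pp; rewrite /r rcosetM (rcoset_id Pp).
exists (fun x => t (u x) * (f (u x) (r x))^-1) => p Pp x.
(* the representative chosen for P itself is 1 *)
have ->: r p = 1 by rewrite /r (rcoset_id Pp) repr_group.
have up : u p = p by rewrite /u /r (rcoset_id Pp) repr_group invg1 mulg1.
have upx : u (p * x) = p * u x by rewrite /u rE // mulgA.
rewrite up f1 divg1 rE // upx [LHS]mulgA [RHS]mulgA; apply: eq_divg.
have fpx : f (u x) (r x) * f p x = f p (u x) * f (p * u x) (r x).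
  by rewrite fE; congr (_ * f p _); rewrite /u mulgVK.
by rewrite -ft // (ACl (2*(3*1))) /= fpx mulgA (mulg_comm (t _)).
Qed.

(** Corestriction after restriction is the |Q : P|-th power.  Dividing f by the
    coboundary of a cochain that trivializes it on P x Q gives a cocycle which
    is 1 on P x Q, hence invariant under P on the left by the cocycle
    identity. *)
Lemma coboundary_expg_index f t : normalized_cocycle f ->
    {in P &, forall x y, f x y * t (x * y) = t x * t y} ->
  coboundary (fun x y => f x y ^+ #|[set: Q] : P|).
Proof.
move=> fZ ft; have [T fT] := trivialize_left fZ ft; have [_ _ fE] := fZ.
pose d x y := T (x * y) * (T x * T y)^-1.
have dE g h k : d h g * d (h * g) k = d g k * d h (g * k).
  rewrite /d !mulgA !invMg !mulgA.
  rewrite [LHS](ACl ((1*6)*(4*5*2*3))) /= mulgV mul1g.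
  by rewrite [RHS](ACl ((1*5)*(4*2*3*6))) /= mulgV mul1g.
have Cd : coboundary d.
  by exists (fun x => (T x)^-1) => x y; rewrite /d mulg_AC mulgV mul1g invMg mulg_comm.
have : coboundary (fun x y => (f x y * d x y) ^+ #|[set: Q] : P|).
  have fdE g h k : f h g * d h g * (f (h * g) k * d (h * g) k)
       = f g k * d g k * (f h (g * k) * d h (g * k)).
    by rewrite mulg_ACA fE dE mulg_ACA.
  apply: (transfer_left_invariant (f := fun x y => f x y * d x y)) => // p Pp x y.
  have fd1 z : f p z * d p z = 1 by rewrite /d mulgA fT // mulgV.
  by have := fdE x p y; rewrite !fd1 mul1g mulg1.
move=> Cfd; have CdV := coboundaryV (coboundaryX #|[set: Q] : P| Cd).
apply: eq_coboundary (coboundaryM Cfd CdV) => x y.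
by rewrite expgMn ?mulgK //; apply: mulg_comm.
Qed.

End Transfer.

(** * A cocycle is a coboundary when its Sylow restrictions are *)

Section SylowCriterion.
Variables (Q : finGroupType) (A : torsionAbGroupType) (f : Q -> Q -> A).

(** The exponents n for which f ^ n is a coboundary are closed under gcd, by
    Bezout.  A prime factor p of N > 1 comes with an exponent n that it does
    not divide, and gcd N n is then a smaller exponent than N. *)
Lemma coboundary_of_exponents N :
    (0 < N)%N -> coboundary (fun x y => f x y ^+ N) ->
    (forall p, prime p -> (p %| N)%N ->
       exists2 n, ~~ (p %| n)%N & coboundary (fun x y => f x y ^+ n)) ->
  coboundary f.
Proof.
elim/ltn_ind: N => N IHN N_gt0 CN Cp.
case: (ltngtP N 1) N_gt0 => // [N_gt1 _|N1 _]; last first.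
  by apply: eq_coboundary CN => x y; rewrite N1.
have p_pr := pdiv_prime N_gt1; have [n p'n Cn] := Cp _ p_pr (pdiv_dvd N).
have N_gt0 := ltnW N_gt1.
case: (@egcdnP N n N_gt0) => u v Duv _.
have Cg : coboundary (fun x y => f x y ^+ gcdn N n).
  have := coboundaryM (coboundaryX u CN) (coboundaryV (coboundaryX v Cn)).
  apply: eq_coboundary => x y; rewrite -!expgnA mulnC Duv mulnC expgnDr.
  by rewrite mulg_AC mulgV mul1g.
apply: IHN Cg _; rewrite ?gcdn_gt0 ?N_gt0 //.
  rewrite ltn_neqAle dvdn_leq ?dvdn_gcdl // andbT.
  apply: contra p'n => /eqP gN; apply: dvdn_trans (pdiv_dvd N) _.
  by rewrite -gN dvdn_gcdr.
by move=> q q_pr /dvdn_trans-/(_ _ (dvdn_gcdl _ _)); apply: Cp.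
Qed.

(** The projection on the p-component is a power map on the values of f, with
    an exponent c that is 1 modulo the p-part of a common multiple N of their
    orders.  By transfer from P, f ^ (c * |Q : P|) is a coboundary, and p does
    not divide this exponent if it divides N. *)
Lemma coboundary_of_Sylow : normalized_cocycle f ->
    (forall p, prime p -> exists (P : {group Q}) (t : Q -> A),
       p.-Sylow([set: Q]) P /\
       {in P &, forall x y, val (pproj p (f x y)) * t (x * y) = t x * t y}) ->
  coboundary f.
Proof.
move=> fZ fP; have [f1 f1' fE] := fZ.
(* any common multiple of the orders of the values of f would do *)
pose N := (\prod_(z : Q * Q) torsion_order (f z.1 z.2))%N.
have N_gt0 : (0 < N)%N by apply: prodn_gt0 => z; apply: torsion_order_gt0.
have dvN x y : (torsion_order (f x y) %| N)%N.
  by rewrite /N (bigD1 (x, y)) //= dvdn_mulr.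
apply: (coboundary_of_exponents N_gt0) => [|p p_pr pN].
  exists (fun _ => 1) => x y; rewrite !mulg1; apply/eqP.
  by rewrite -torsion_order_dvdn.
have [P [t [sylP ft]]] := fP p p_pr; set c := chinese N`_p N`_p^' 1 0.
have cE : c = 1 %[mod N`_p] by apply: chinese_modl; apply: coprime_partC.
exists (c * #|[set: Q] : P|)%N.
  rewrite Euclid_dvdM // negb_or; apply/andP; split.
    have /(congr1 (modn^~ p)) := cE.
    have pNp : (p %| N`_p)%N.
      by rewrite p_part dvdn_exp // logn_gt0 mem_primes p_pr N_gt0.
    rewrite !modn_dvdm // /dvdn => ->.
    by rewrite modn_small ?prime_gt1.
  have [_ _] := and3P sylP; rewrite p'natE //.
have fcZ : normalized_cocycle (fun x y => f x y ^+ c).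
  split=> [g|g|g h k]; rewrite ?f1 ?f1' ?expg1n //.
  by rewrite -!expgMn ?fE //; apply: mulg_comm.
apply: eq_coboundary (coboundary_expg_index (t := t) (P := P) fcZ _) => x y.
  by rewrite expgnA.
by move=> Px Py; rewrite -ft //= (pproj_valE p N_gt0).
Qed.

End SylowCriterion.

(** * Gluing maps along a decomposition into primary components *)

Section BareMorphism.
Variables (G H : groupType) (f : G -> H).
Hypothesis fM : {morph f : x y / x * y}.

Lemma morph_1 : f 1 = 1.
Proof. by apply: (mulgI (f 1)); rewrite -fM !mulg1. Qed.

Lemma morph_expg x n : f (x ^+ n) = f x ^+ n.
Proof. by elim: n => [|n IHn]; rewrite ?morph_1 // !expgS fM IHn. Qed.

Lemma morph_inv x : f x^-1 = (f x)^-1.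
Proof. by apply: (mulgI (f x)); rewrite -fM !mulgV morph_1. Qed.

Lemma can2_morphM g : cancel f g -> cancel g f -> {morph g : x y / x * y}.
Proof. by move=> fK gK x y; apply: (canLR fK); rewrite fM !gK. Qed.

End BareMorphism.

Section PrimaryGluing.
Variable G : groupType.

(** Presents G as the restricted direct product of the images of the pr p.
    It has two instances below, the torsion abelian groups and the finite
    nilpotent groups.  The support is a list rather than a predicate so
    that products over it can be formed; it may be larger than the set of p
    with pr p x <> 1. *)
Record primary_decomposition := PrimaryDecomposition {
  pr : nat -> G -> G;
  supp : G -> seq nat;
  prM : forall p, {morph pr p : x y / x * y};
  pr_pr : forall p q x, pr q (pr p x) = if p == q then pr p x else 1;
  pr_sep : forall x, (forall p, pr p x = 1) -> x = 1;
  supp_uniq : forall x, uniq (supp x);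
  pr_notin_supp : forall p x, p \notin supp x -> pr p x = 1
}.

Variable D : primary_decomposition.
Implicit Types (f g : nat -> G -> G) (x y : G).

Lemma pr_one p : pr D p 1 = 1. Proof. exact: (morph_1 (prM D p)). Qed.

Lemma pr_inj x y : (forall p, pr D p x = pr D p y) -> x = y.
Proof.
move=> eq_xy; apply: (mulIg y^-1); rewrite mulgV; apply: (@pr_sep D) => p.
by rewrite prM eq_xy -prM mulgV pr_one.
Qed.

Definition glue f x : G := \prod_(p <- supp D x) f p (pr D p x).

(** The maps f p are defined on all of G, but only their values on the image of
    pr p matter for gluing. *)
Definition local_family f : Prop :=
  (forall p, f p 1 = 1) /\ (forall p x, pr D p (f p x) = f p x).

(** The defining property of the glued map.  By pr_inj, every algebraic identity
    for glue f thereby reduces to the same identity for the f p; in particular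
    the dependence of the product on the list supp D x is harmless. *)
Lemma pr_glue f : local_family f ->
  forall q x, pr D q (glue f x) = f q (pr D q x).
Proof.
case=> f1 fpr q x; rewrite /glue (big_morph _ (prM D q) (pr_one q)).
have others p : p != q -> pr D q (f p (pr D p x)) = 1.
  by move=> /negPf npq; rewrite -fpr pr_pr npq.
have [q_in|/pr_notin_supp qx1] := boolP (q \in supp D x); last first.
  rewrite qx1 f1 big1_seq // => p _; have [->|/others //] := eqVneq p q.
  by rewrite qx1 f1 pr_one.
case/splitPr: q_in (supp_uniq D x) => s1 s2.
rewrite cat_uniq /= negb_or => /and4P[_ /andP[q_s1 _] q_s2 _].
rewrite big_cat big_cons /= !big1_seq ?mul1g ?mulg1 ?fpr // => p /=.
  by move=> p_s2; apply: others; apply: contraNneq q_s2 => <-.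
by move=> p_s1; apply: others; apply: contraNneq q_s1 => <-.
Qed.

Lemma glueM f : local_family f ->
    (forall p x y,
       f p (pr D p x * pr D p y) = f p (pr D p x) * f p (pr D p y)) ->
  {morph glue f : x y / x * y}.
Proof.
by move=> fL fM x y; apply: pr_inj => p; rewrite prM !pr_glue // prM fM.
Qed.

Lemma glueK f g : local_family f -> local_family g ->
    (forall p x, g p (f p (pr D p x)) = pr D p x) ->
  cancel (glue f) (glue g).
Proof. by move=> fL gL fK x; apply: pr_inj => p; rewrite !pr_glue. Qed.

Lemma glue_commute f : local_family f ->
    (forall p x, commute (f p (pr D p x)) (pr D p x)) ->
  forall x, commute (glue f x) x.
Proof.
by move=> fL fC x; apply: pr_inj => p; rewrite !prM pr_glue //; apply: fC.
Qed.

Lemma glue_component f p x : local_family f -> pr D p x = x -> glue f x = f p x.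
Proof.
move=> fL px; apply: pr_inj => q; rewrite pr_glue // -{1}px pr_pr.
have [<-|npq] := eqVneq p q; first by rewrite fL.2 px.
by rewrite fL.1 -(fL.2 p) pr_pr (negPf npq).
Qed.

End PrimaryGluing.

(** * The primary decompositions of the two groups *)

Section TorsionDecomposition.
Variable A : torsionAbGroupType.
Implicit Type x : A.

Lemma p'nat_notin_primes p n : (0 < n)%N -> p \notin primes n -> p^'.-nat n.
Proof.
move=> n_gt0; apply: contraR; rewrite /pnat n_gt0 /= => /allPn[q q_n].
by rewrite !inE negbK => /eqP <-.
Qed.

Lemma pproj_pproj p q x :
  val (pproj q (val (pproj p x))) = if p == q then val (pproj p x) else 1.
Proof.
have [<-|npq] := eqVneq p q; first by rewrite pprojK.
rewrite pproj_p'elt ?val1 //; have := valP (pproj p x).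
by apply: sub_in_pnat => r _ /eqP ->; rewrite !inE.
Qed.

(** If p divides the order n of x, then the exponent c with pproj p x = x ^ c
    is 1 modulo p, so n does not divide c and pproj p x is not trivial. *)
Lemma pproj_sep x : (forall p, val (pproj p x) = 1) -> x = 1.
Proof.
move=> px; set n := torsion_order x.
have n_gt0 : (0 < n)%N := torsion_order_gt0 x.
suffices n1 : n = 1%N by rewrite -[x]expg1 -n1 expg_torsion_order.
apply/eqP/negPn/negP=> n_neq1.
have n_gt1 : (1 < n)%N by case: (n) n_gt0 n_neq1 => [|[]].
have p_pr := pdiv_prime n_gt1; set p := pdiv n in p_pr *.
have := px p; rewrite /= /pproj_val -/n; set c := chinese _ _ _ _.
move/eqP; rewrite -torsion_order_dvdn -/n => n_c.
have := @chinese_modl _ _ (coprime_partC p n n) 1 0; rewrite -/c.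
have pn : (p %| n`_p)%N.
  by rewrite p_part dvdn_exp // logn_gt0 mem_primes p_pr n_gt0 pdiv_dvd.
move/(congr1 (modn^~ p)); rewrite !modn_dvdm // (modn_small (prime_gt1 p_pr)).
by rewrite (eqP (dvdn_trans (pdiv_dvd n) n_c)).
Qed.

Lemma pproj_notin_primes p x :
  p \notin primes (torsion_order x) -> val (pproj p x) = 1.
Proof.
move=> p_x; rewrite pproj_p'elt ?val1 //.
exact: p'nat_notin_primes (torsion_order_gt0 x) p_x.
Qed.

Lemma val_pprojM p : {morph (fun x => val (pproj p x)) : x y / x * y}.
Proof. by move=> x y; rewrite pprojM valM. Qed.

Definition torsion_decomposition : primary_decomposition A :=
  PrimaryDecomposition val_pprojM pproj_pproj pproj_sep
    (fun x => primes_uniq (torsion_order x)) pproj_notin_primes.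

Lemma pr_torsion p x : pr torsion_decomposition p x = val (pproj p x).
Proof. by []. Qed.

End TorsionDecomposition.

Lemma morph_pproj (A B : torsionAbGroupType) (f : A -> B) p x :
  {morph f : x y / x * y} -> val (pproj p (f x)) = f (val (pproj p x)).
Proof.
move=> fM; rewrite /= (pproj_valE p (torsion_order_gt0 x)); last first.
  by rewrite torsion_order_dvdn -(morph_expg fM) expg_torsion_order (morph_1 fM).
by rewrite /pproj_val morph_expg.
Qed.

Section NilpotentDecomposition.
Variable Q : finGroupType.
Hypothesis nilQ : nilpotent [set: Q].
Implicit Types x y : Q.

Lemma mem_pcore_nil (p : nat) x : (x \in 'O_p([set: Q])) = p.-elt x.
Proof.
exact: mem_normal_Hall (nilpotent_pcore_Hall p nilQ) (pcore_normal _ _) (in_setT x).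
Qed.

(** In a nilpotent group, taking the p-part of an element is the projection on
    the first factor of the direct product of 'O_p and 'O_p^'. *)
Lemma consttM_nil (p : nat) : {morph (fun x => x.`_p) : x y / x * y}.
Proof.
have /dprodP[_ defQ cPP' _] := nilpotent_pcoreC p nilQ.
have split_constt u v : u \in 'O_p([set: Q]) -> v \in 'O_p^'([set: Q]) ->
    (u * v).`_p = u.
  move=> Pu P'v; rewrite consttM; last exact/esym/(centsP cPP').
  rewrite (constt_p_elt (mem_p_elt (pcore_pgroup _ _) Pu)).
  by rewrite (constt1P (mem_p_elt (pcore_pgroup _ _) P'v)) mulg1.
have splitQ x : x \in 'O_p([set: Q]) * 'O_p^'([set: Q]) by rewrite defQ inE.
move=> x y; have [u v Pu P'v ->] := mulsgP (splitQ x).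
have [u' v' Pu' P'v' ->] := mulsgP (splitQ y).
have vu' : v * u' = u' * v by apply: (centsP cPP').
rewrite mulgA -(mulgA u) vu' !mulgA -[LHS]/((_ * _ * _ * _).`_p) -mulgA.
by rewrite !split_constt ?groupM.
Qed.

Lemma constt_constt (p q : nat) x : (x.`_p).`_q = if p == q then x.`_p else 1.
Proof.
have [<-|npq] := eqVneq p q; first exact: constt_p_elt (p_elt_constt _ _).
apply/constt1P; apply: sub_in_pnat (p_elt_constt p x) => r _ /eqP ->.
by rewrite !inE.
Qed.

Lemma constt_sep x : (forall p : nat, x.`_p = 1) -> x = 1.
Proof. by move=> x1; rewrite -(prod_constt x) big1. Qed.

Lemma constt_notin_primes (p : nat) x : p \notin primes #|Q| -> x.`_p = 1.
Proof.
move=> p_Q; apply/constt1P; apply: (@pnat_dvd _ #|[set: Q]|).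
  by rewrite order_dvdG ?inE.
by apply: p'nat_notin_primes; rewrite ?cardG_gt0 // cardsT.
Qed.

Definition nilpotent_decomposition : primary_decomposition Q :=
  PrimaryDecomposition consttM_nil constt_constt constt_sep
    (fun x => primes_uniq #|Q|) constt_notin_primes.

End NilpotentDecomposition.

(** * Upper isomorphisms as triples *)

(** The inverses are part of the data so that they can be restricted and glued
    like the maps themselves. *)
Record upper_data (Q : groupType) (A : abGroupType) := UpperData {
  kernel_map : A -> A;
  kernel_inv : A -> A;
  quotient_map : Q -> Q;
  quotient_inv : Q -> Q;
  cochain : Q -> A
}.

Record upper_data_spec (Q : groupType) (A : abGroupType) (e e' : cocycle Q A)
    (d : upper_data Q A) : Prop := UpperDataSpec {
  kernel_mapM : {morph kernel_map d : x y / x * y};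
  kernel_mapK : cancel (kernel_map d) (kernel_inv d);
  kernel_invK : cancel (kernel_inv d) (kernel_map d);
  quotient_mapM : {morph quotient_map d : x y / x * y};
  quotient_mapK : cancel (quotient_map d) (quotient_inv d);
  quotient_invK : cancel (quotient_inv d) (quotient_map d);
  quotient_map_commute : forall y, commute (quotient_map d y) y;
  cochainE : forall y z, kernel_map d (e y z) * cochain d (y * z) =
    cochain d y * cochain d z * e' (quotient_map d y) (quotient_map d z)
}.

Section UpperIsomorphismData.
Variables (Q : groupType) (A : abGroupType) (e e' : cocycle Q A).

(** The equation for the cochain says that (x, y) |-> (a x * t y, r y) is
    multiplicative; it also forces t 1 = 1, so that this map sends A onto A. *)
Lemma upper_data_isomorphic d : upper_data_spec e e' d -> upper_A_isomorphic e e'.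
Proof.
case: d => a a' r r' t [/= aM aK a'K rM rK r'K rC tE].
have t1 : t 1 = 1.
  apply: (mulgI (t 1)); rewrite mulg1; have := tE 1 1.
  by rewrite (morph_1 rM) !cocycleg1 (morph_1 aM) !mulg1 mul1g => <-.
pose phi (u : perturbed_prod e) : perturbed_prod e' := (a u.1 * t u.2, r u.2).
have phiM : {morph phi : u v / u * v}.
  move=> [x y] [x' y']; rewrite /phi !perturbed_mulE /= rM !aM.
  by rewrite -(mulgA (a x * a x')) tE mulgA mulg_ACA.
pose phiH := isMultiplicative.Build _ _ phi phiM.
pose phiS : {multiplicative perturbed_prod e -> perturbed_prod e'} :=
  HB.pack phi phiH.
exists phiS; split.
- exists (fun v => (a' (v.1 * (t (r' v.2))^-1), r' v.2)) => -[x y].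
    by rewrite /= /phi /= rK mulgK aK.
  by rewrite /= /phi /= r'K a'K mulgVK.
- move=> [x y]; split=> [[[x' y'] /= -> [_ <-]]|/= ->].
    exact: morph_1.
  exists (a' x, 1) => //=; rewrite /phi /= t1 mulg1 a'K (morph_1 rM) //.
- by split=> //; exists r'.
Qed.

(** The cochain is the A-component of the image of 1 x Q; its equation is the
    image under phi of (e y z, 1) * (1, y * z) = (1, y) * (1, z). *)
Lemma isomorphic_upper_data :
  upper_A_isomorphic e e' -> exists d, upper_data_spec e e' d.
Proof.
case=> phi [[psi phiK psiK] phiA [rM [r' rK r'K] rC]].
have phi2 x : (phi (x, 1)).2 = 1 by apply/phiA; exists (x, 1).
have psi2 x : (psi (x, 1)).2 = 1.
  by have /phiA[u u2 <-] : ((x, 1) : perturbed_prod e').2 = 1; rewrite // phiK.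
have pair_eq (u : A * Q) : u.2 = 1 -> (u.1, 1) = u by case: u => x y /= ->.
have phiM u v : phi (u * v) = phi u * phi v by exact: gmulfM.
have mulA (x x' : A) : ((x, 1) : perturbed_prod e) * (x', 1) = (x * x', 1).
  by rewrite perturbed_mulE /= cocycleg1 !mulg1.
exists (UpperData (fun x => (phi (x, 1)).1) (fun x => (psi (x, 1)).1)
  (comp22 phi) r' (fun y => (phi (1, y)).1)).
split=> //=.
- move=> x x'; have := phiM (x, 1) (x', 1); rewrite mulA => ->.
  by rewrite perturbed_mulE /= !phi2 cocycleg1 mulg1.
- by move=> x; rewrite (pair_eq _ (phi2 x)) phiK.
- by move=> x; rewrite (pair_eq _ (psi2 x)) psiK.
- move=> y z; have Eyz : ((e y z, 1) : perturbed_prod e) * (1, y * z) =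
      ((1, y) : perturbed_prod e) * (1, z).
    by rewrite !perturbed_mulE /= cocycle1g !mulg1 !mul1g.
  have /(congr1 fst) := congr1 phi Eyz; rewrite !phiM !perturbed_mulE /=.
  by rewrite phi2 cocycle1g mulg1.
Qed.

End UpperIsomorphismData.

(** * Restriction to the Sylow subgroups and gluing *)

(** The hypotheses provide isomorphisms for one prime at a time; since only
    finitely many primes matter, induction makes a family of them, with d0
    filling in elsewhere. *)
Lemma finite_choice (I : eqType) (T : I -> Type) (R : forall i, T i -> Prop)
    (d0 : forall i, T i) (s : seq I) :
    (forall i, i \in s -> exists d, R i d) ->
    (forall i, i \notin s -> R i (d0 i)) ->
  exists d : forall i, T i, forall i, R i (d i).
Proof.
elim: s d0 => [|i s IHs] d0 Rs R0; first by exists d0 => i; apply: R0.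
have [di Rdi] := Rs i (mem_head i s).
apply: (IHs (dfwith d0 di)) => [j j_s | j j_s].
  by apply: Rs; rewrite inE j_s orbT.
have [<-|nij] := eqVneq i j; first by rewrite dfwith_in.
by rewrite dfwith_out //; apply: R0; rewrite inE eq_sym negb_or nij.
Qed.

Section Restriction.
Variables (Q : finGroupType) (A : torsionAbGroupType) (e1 e2 : cocycle Q A).
Hypothesis nilQ : nilpotent [set: Q].

Lemma morph_p_elt_nil (p : nat) (r : Q -> Q) x :
  {morph r : x y / x * y} -> x \in 'O_p([set: Q]) -> r x \in 'O_p([set: Q]).
Proof.
move=> rM; rewrite !mem_pcore_nil //; apply: pnat_dvd.
by rewrite order_dvdn -(morph_expg rM) expg_order (morph_1 rM).
Qed.

(** P = 'O_p consists of all the p-elements of Q, so automorphisms of Q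
    restrict to P; the automorphisms of A commute with the projections on the
    p-components, because these are power maps. *)
Lemma restrict_upper_data (p : nat) (P : {group Q}) d :
    P \in 'Syl_p([set: Q]) -> upper_data_spec e1 e2 d ->
  exists d', upper_data_spec (induced_cocycle p P e1) (induced_cocycle p P e2) d'.
Proof.
rewrite inE => /(nilpotent_Hall_pcore nilQ) defP.
case: d => a a' r r' t [/= aM aK a'K rM rK r'K rC tE].
have a'M := can2_morphM aM aK a'K; have r'M := can2_morphM rM rK r'K.
have rP (u : [subg P]) : r (sgval u) \in P.
  by rewrite defP morph_p_elt_nil // -defP subgP.
have r'P (u : [subg P]) : r' (sgval u) \in P.
  by rewrite defP morph_p_elt_nil // -defP subgP.
exists (UpperData (fun x : pcomponent A p => pproj p (a (val x)))
  (fun x : pcomponent A p => pproj p (a' (val x)))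
  (fun u : subg_of P => subg P (r (sgval u)))
  (fun u : subg_of P => subg P (r' (sgval u)))
  (fun u : subg_of P => pproj p (t (sgval u)))).
split=> /=.
- by move=> x y; rewrite valM aM pprojM.
- by move=> x; rewrite (morph_pproj _ _ aM) pprojK aK pprojK.
- by move=> x; rewrite (morph_pproj _ _ a'M) pprojK a'K pprojK.
- by move=> u v; apply: val_inj; rewrite /= !subgK ?rM ?groupM ?rP.
- by move=> u; rewrite subgK // rK sgvalK.
- by move=> u; rewrite subgK // r'K sgvalK.
- by move=> u; apply: val_inj; rewrite /= !subgK //; apply: rC.
move=> u v; rewrite /induced_fun !subgK // -!pprojM -tE pprojM.
rewrite (pprojM _ (a _)); congr (_ * _).
by rewrite -(morph_pproj _ _ aM) pprojK.
Qed.

End Restriction.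

Section Gluing.
Variables (Q : finGroupType) (A : torsionAbGroupType) (e1 e2 : cocycle Q A).
Hypothesis nilQ : nilpotent [set: Q].

Local Notation Op p := ('O_p([set: Q])%G).
Local Notation DA := (torsion_decomposition A).
Local Notation DQ := (nilpotent_decomposition nilQ).

Definition torsion_family (k : forall p, pcomponent A p -> pcomponent A p)
  (p : nat) (x : A) : A := val (k p (pproj p x)).

Definition nilpotent_family (r : forall p : nat, subg_of (Op p) -> subg_of (Op p))
  (p : nat) (x : Q) : Q := sgval (r p (subg (Op p) x)).

Lemma torsion_family_local k : (forall p, k p 1 = 1) ->
  local_family DA (torsion_family k).
Proof.
move=> k1; split=> [p|p x]; first by rewrite /torsion_family pproj1 k1 val1.
by rewrite pr_torsion pprojK.
Qed.

Lemma nilpotent_family_local r : (forall p, r p 1 = 1) ->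
  local_family DQ (nilpotent_family r).
Proof.
move=> r1; split=> [p|p x]; last by rewrite /= constt_p_elt // -mem_pcore_nil // subgP.
by rewrite /nilpotent_family -{1}[1]/(sgval (1 : subg_of (Op p))) sgvalK r1.
Qed.

Lemma constt_pcore (p : nat) (x : Q) : x.`_p \in Op p.
Proof. by rewrite mem_pcore_nil // p_elt_constt. Qed.

(** The glued maps alpha and rho induce the given ones on components, so for
    each p the p-part of alpha (e1 y z) / e2 (rho y) (rho z) is, on 'O_p x 'O_p,
    the coboundary of the given cochain.  The cochain for the whole of Q is the
    one that the Sylow criterion provides. *)
Lemma glue_upper_data
    (d : forall p : nat, upper_data (subg_of (Op p)) (pcomponent A p)) :
    (forall p, upper_data_spec (induced_cocycle p (Op p) e1)
                 (induced_cocycle p (Op p) e2) (d p)) ->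
  exists d', upper_data_spec e1 e2 d'.
Proof.
move=> dP.
pose a p := kernel_map (d p); pose a' p := kernel_inv (d p).
pose r p := quotient_map (d p); pose r' p := quotient_inv (d p).
have aK p : cancel (a p) (a' p) := kernel_mapK (dP p).
have a'K p : cancel (a' p) (a p) := kernel_invK (dP p).
have rK p : cancel (r p) (r' p) := quotient_mapK (dP p).
have r'K p : cancel (r' p) (r p) := quotient_invK (dP p).
have a1 p : a p 1 = 1 := morph_1 (kernel_mapM (dP p)).
have a'1 p : a' p 1 = 1 by rewrite -(a1 p) aK.
have r1 p : r p 1 = 1 := morph_1 (quotient_mapM (dP p)).
have r'1 p : r' p 1 = 1 by rewrite -(r1 p) rK.
have aL := torsion_family_local a1; have a'L := torsion_family_local a'1.
have rL := nilpotent_family_local r1; have r'L := nilpotent_family_local r'1.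
pose alpha := glue DA (torsion_family a); pose alpha' := glue DA (torsion_family a').
pose rho := glue DQ (nilpotent_family r); pose rho' := glue DQ (nilpotent_family r').
have alphaM : {morph alpha : x y / x * y}.
  apply: (glueM aL) => p x y; rewrite /torsion_family !pr_torsion.
  by rewrite pprojM !pprojK -valM -(kernel_mapM (dP p)).
have rhoM : {morph rho : x y / x * y}.
  apply: (glueM rL) => p x y; rewrite /nilpotent_family /=.
  rewrite subgM ?constt_pcore // /r (quotient_mapM (dP p)) //.
have fE : normalized_cocycle
    (fun y z => alpha (e1 y z) * (e2 (rho y) (rho z))^-1).
  split=> [g|g|g h k].
  - by rewrite (morph_1 rhoM) !cocycleg1 (morph_1 alphaM) invg1 mulg1.
  - by rewrite (morph_1 rhoM) !cocycle1g (morph_1 alphaM) invg1 mulg1.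
  rewrite mulg_ACA -alphaM cocycleE -invgM !rhoM.
  rewrite (mulg_comm (e2 (rho h * rho g) _)) cocycleE.
  by rewrite alphaM (mulg_comm (e2 (rho g) _)) invgM mulg_ACA.
have [p p_pr|t tE] := coboundary_of_Sylow fE.
  exists (Op p), (fun y => val (cochain (d p) (subg (Op p) y))).
  split=> [|y z Py Pz]; first exact: nilpotent_pcore_Hall.
  have rhoE x : x \in Op p -> rho x = sgval (r p (subg (Op p) x)).
    move=> Px; apply: (@glue_component _ DQ _ p _ rL) => /=.
    by rewrite constt_p_elt // -mem_pcore_nil.
  have := congr1 val (cochainE (dP p) (subg (Op p) y) (subg (Op p) z)).
  rewrite !valM [induced_cocycle _ _ _ _ _]/(pproj p _).
  rewrite [induced_cocycle _ _ _ _ _]/(pproj p _) !subgK // -!rhoE // -subgM //.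
  move=> tE.
  have prV v := morph_inv (@val_pprojM A p) v.
  rewrite pprojM valM prV.
  rewrite [val (pproj p (alpha _))](pr_glue aL) /torsion_family !pr_torsion.
  by rewrite pprojK mulg_AC tE mulgK.
exists (UpperData alpha alpha' rho rho' t); split=> //=.
- apply: glueK => // p x; rewrite /torsion_family !pr_torsion !pprojK.
  by rewrite aK.
- apply: glueK => // p x; rewrite /torsion_family !pr_torsion !pprojK.
  by rewrite a'K.
- apply: glueK => // p x; rewrite /nilpotent_family sgvalK.
  by rewrite rK subgK //; apply: constt_pcore.
- apply: glueK => // p x; rewrite /nilpotent_family sgvalK.
  by rewrite r'K subgK //; apply: constt_pcore.
- apply: glue_commute => // p x /=; have Px := constt_pcore p x.
  have /(congr1 (@sgval _ _)) := quotient_map_commute (dP p) (subg (Op p) x.`_p).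
  by rewrite /= subgK.
by move=> y z; rewrite -tE mulg_AC mulgVK.
Qed.

End Gluing.

Theorem proposition5p4 (G1 : torsionAbGroupType) (G2 : finGroupType)
    (e1 e2 : cocycle G2 G1)
    (nilG2 : nilpotent [set: G2])
    (coclassG2 : forall (p : nat) (P : {group G2}),
       p \in \pi(#|G2|) -> P \in 'Syl_p([set: G2]) -> (coclass p P <= 2)%N) :
  upper_A_isomorphic e1 e2 <->
  (forall (p : nat) (P : {group G2}),
     p \in \pi(#|G2|) -> P \in 'Syl_p([set: G2]) ->
     upper_A_isomorphic (induced_cocycle p P e1) (induced_cocycle p P e2)).
Proof.
split=> [/isomorphic_upper_data[d dP] p P _ sylP | isoP].
  have [d' d'P] := restrict_upper_data nilG2 sylP dP.
  exact: upper_data_isomorphic d'P.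
(* For p not dividing #|G2| the Sylow p-subgroup is trivial, and the identity
   maps serve. *)
pose d0 (p : nat) : upper_data (subg_of 'O_p([set: G2])%G) (pcomponent G1 p) :=
  UpperData id id id id (fun _ => 1).
have [p p_G2|p p_G2|d dP] := @finite_choice nat _
  (fun p : nat => upper_data_spec (induced_cocycle p 'O_p([set: G2]) e1)
                    (induced_cocycle p 'O_p([set: G2]) e2))
  d0 (primes #|G2|).
- apply: isomorphic_upper_data; apply: isoP => //.
  by rewrite inE nilpotent_pcore_Hall.
- split=> //= u v.
  have sub1 (w : subg_of 'O_p([set: G2])%G) : sgval w = 1.
    have Pw := subgP w; rewrite -(constt_notin_primes (sgval w) p_G2).
    by rewrite constt_p_elt // -mem_pcore_nil.
  by rewrite /induced_fun !sub1 !cocycle1g pproj1 !mulg1.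
have [d' d'P] := glue_upper_data nilG2 dP.
exact: upper_data_isomorphic d'P.
Qed.
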